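(* Let $r\ge 2$ be an integer. If $\mathcal F_1,\dots,\mathcal F_r\subseteq 2^{[n]}$ are $r$-cross-intersecting, then $$\sum_{i=1}^r\mu_{(r-1)/r}(\mathcal F_i)\le r-1.$$
   Context: $[n]=\{1,\dots,n\}$ and $2^{[n]}$ is its power set. For $0\le p\le 1$ and $\mathcal F\subseteq 2^{[n]}$, the $p$-biased measure is $\mu_p(\mathcal F)=\sum_{F\in\mathcal F}p^{|F|}(1-p)^{n-|F|}$. Families $\mathcal F_1,\dots,\mathcal F_r\subseteq 2^{[n]}$ are $r$-cross-intersecting if $A_1\cap\cdots\cap A_r\neq\varnothing$ for every choice of $A_i\in\mathcal F_i$, $i\in[r]$ (vacuously true if some $\mathcal F_i$ is empty). *)

(* Defs.v *)
From mathcomp Require Import all_boot all_order all_algebra.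
Set Implicit Arguments.
Unset Strict Implicit.
Unset Printing Implicit Defensive.
Import Order.TTheory GRing.Theory Num.Theory.
Local Open Scope ring_scope.

(* The ground set {1, ..., n} is represented by 'I_n = {0, ..., n-1}. *)
Definition mu (R : realFieldType) (n : nat) (p : R) (F : {set {set 'I_n}}) : R :=
  \sum_(A in F) p ^+ #|A| * (1 - p) ^+ (n - #|A|).

Definition cross_intersecting (n r : nat) (F : 'I_r -> {set {set 'I_n}}) : Prop :=
  forall A : 'I_r -> {set 'I_n},
    (forall i, A i \in F i) -> \bigcap_(i < r) A i != set0.

(* Main.v *)
(* Colour each point of the ground set uniformly at random with one of r colours
   and let A_i be the set of points whose colour is not i. Each A_i follows the
   (r-1)/r-biased measure, while the intersection of all the A_i is empty; so at
   most r-1 of the events "A_i belongs to F_i" occur, and the bound follows by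
   taking expectations. *)
Require Import Defs.
From mathcomp Require Import all_boot all_order all_algebra.
Import Order.TTheory GRing.Theory Num.Theory.
Local Open Scope ring_scope.

Definition avoiders {n r : nat} (c : {ffun 'I_n -> 'I_r}) (i : 'I_r) : {set 'I_n} :=
  [set x | c x != i].

Lemma bigcap_avoiders (n r : nat) (c : {ffun 'I_n -> 'I_r}) :
  \bigcap_(i < r) avoiders c i = set0.
Proof.
apply/setP=> x; rewrite inE; apply/negbTE/negP=> /bigcapP/(_ (c x) isT).
by rewrite inE eqxx.
Qed.

(** The condition splits over points: a point of [A] may take any of the [r.-1] colours other than
    [i], while a point outside [A] must get colour [i]. *)
Lemma card_avoiders_eq (n r : nat) (i : 'I_r) (A : {set 'I_n}) :
  #|[set c : {ffun 'I_n -> 'I_r} | avoiders c i == A]| = (r.-1 ^ #|A|)%N.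
Proof.
pose D x := if x \in A then predC1 i else pred1 i.
have -> : #|[set c : {ffun 'I_n -> 'I_r} | avoiders c i == A]| = #|family D|.
  apply: eq_card => c; rewrite inE; apply/eqP/familyP => [defA x | cD].
    by rewrite /D -defA inE; case: ifP => [|/negbFE]; rewrite inE.
  apply/setP=> x; have := cD x; rewrite /D !inE.
  by case: ifP => _; rewrite !inE; [move=> -> | move=> ->].
rewrite card_family foldrE big_map big_enum /=.
rewrite (bigID (mem A)) /= [X in (_ * X)%N]big1 ?muln1; last first.
  by move=> x /negbTE xA; rewrite /D xA card1.
rewrite (eq_bigr (fun=> r.-1)) ?prod_nat_const // => x xA.
by rewrite /D xA cardC1 card_ord.
Qed.

(** The distribution of [avoiders c i], scaled by the number [r ^ n] of colourings so that
    probabilities become counts. *)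
Lemma mu_avoiders (R : realFieldType) (n r : nat) (i : 'I_r) (F : {set {set 'I_n}}) :
  mu ((r%:R - 1) / r%:R : R) F * r%:R ^+ n =
  \sum_(c : {ffun 'I_n -> 'I_r}) (avoiders c i \in F)%:R.
Proof.
have r_gt0 : (0 < r)%N by apply: leq_trans (ltn_ord i).
have rN0 : r%:R != 0 :> R by rewrite pnatr_eq0 -lt0n.
rewrite /mu mulr_suml.
transitivity (\sum_(A in F) \sum_(c : {ffun 'I_n -> 'I_r} | avoiders c i == A) (1%:R : R)).
  apply: eq_bigr => A _; rewrite -natr_sum sum1dep_card card_avoiders_eq natrX.
  have -> : 1 - (r%:R - 1) / r%:R = r%:R^-1 :> R.
    by rewrite mulrBl divff // mul1r opprB addrC subrK.
  have An : (#|A| <= n)%N by rewrite -[n in (_ <= n)%N]card_ord max_card.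
  (* Splitting the power clears denominators separately: points of [A] contribute [r - 1] each, the
     others [1]. *)
  have -> : r%:R ^+ n = r%:R ^+ #|A| * r%:R ^+ (n - #|A|) :> R.
    by rewrite -exprD subnKC.
  by rewrite mulrACA -!exprMn divfK // mulVf // expr1n mulr1 -subn1 natrB.
(* For fixed [c], only [A = avoiders c i] can contribute. *)
rewrite (exchange_big_dep predT) //=; apply: eq_bigr => c _.
have [cF | /negP cF] := boolP (avoiders c i \in F).
  rewrite (big_pred1 (avoiders c i)) // => A /=.
  by rewrite eq_sym; case: eqP => [->|_]; rewrite ?cF ?andbF.
by rewrite big1 // => A /andP[AF /eqP cA]; case: cF; rewrite cA.
Qed.

Theorem lemma3p1 (R : realFieldType) (n r : nat) (hr : (2 <= r)%N)
  (F : 'I_r -> {set {set 'I_n}}) (hF : cross_intersecting F) :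
  \sum_(i < r) mu ((r%:R - 1) / r%:R : R) (F i) <= r%:R - 1.
Proof.
have r_gt0 : (0 < r)%N by apply: leq_trans hr.
have rn_gt0 : 0 < r%:R ^+ n :> R by rewrite exprn_gt0 // ltr0n.
rewrite -(ler_pM2r rn_gt0) mulr_suml.
under eq_bigr => i _ do rewrite (mu_avoiders _ _ _ i).
rewrite exchange_big /=.
have -> : (r%:R - 1) * r%:R ^+ n = \sum_(c : {ffun 'I_n -> 'I_r}) (r.-1%:R : R).
  by rewrite sumr_const card_ffun !card_ord -[RHS]mulr_natr natrX -subn1 natrB.
(* The bound now holds colouring by colouring; it is restated as a strict bound by [r]. *)
apply: ler_sum => c _; rewrite -natr_sum ler_nat -ltnS prednK //.
(* Otherwise the sets [avoiders c i] would be a choice from the families with empty intersection. *)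
have [j jF] : exists j, avoiders c j \notin F j.
  apply/existsP; rewrite -negb_forall; apply/negP => /forallP /hF.
  by rewrite bigcap_avoiders eqxx.
rewrite (bigD1 j) //= (negbTE jF) add0n.
apply: (@leq_ltn_trans (\sum_(i < r | i != j) 1)).
  by apply: leq_sum => i _; apply: leq_b1.
by rewrite sum1_card cardC1 card_ord prednK.
Qed.
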